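(* Let $(q_i)$ be a sequence of prime powers and $(d_i)$ a sequence of integers $d_i\geq 2$ such that $n_i=(q_i^{d_i}-1)/(q_i-1)$ is prime for every $i$ and $d_i\to\infty$. Then the number of isolated vertices of $\Lambda(A_{n_i})$ tends to infinity.
   Context: A subset $\{x_1,\ldots,x_t\}$ of a finite group $G$ invariably generates $G$ if $\langle x_1^{g_1},\ldots,x_t^{g_t}\rangle=G$ for all $g_1,\ldots,g_t\in G$ (where $x^g$ denotes a conjugate of $x$). The invariably generating graph $\Lambda(G)$ is the undirected graph whose vertices are the conjugacy classes of $G$ different from $\{1\}$, two vertices $x^G$ and $y^G$ being adjacent if and only if $\{x,y\}$ invariably generates $G$. A vertex is isolated if it is adjacent to no vertex. *)

(* Defs.v *)
From mathcomp Require Import all_boot all_fingroup all_solvable.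
Set Implicit Arguments.
Unset Strict Implicit.
Unset Printing Implicit Defensive.

Import GroupScope.

Definition prime_power (q : nat) : Prop :=
  exists p k : nat, [/\ prime p, (0 < k)%N & q = (p ^ k)%N].

(* The function g chooses, independently for each x in X, the element of G
   by which x is conjugated. *)
Definition invariably_generates (gT : finGroupType) (G : {group gT})
    (X : {set gT}) : bool :=
  (X \subset G) &&
  [forall g : {ffun gT -> gT}, [forall x in X, g x \in G] ==>
     (<<[set x ^ g x | x in X]>> == G)].

Section InvariablyGeneratingGraph.
Variables (gT : finGroupType) (G : {group gT}).

Definition lambda_vertices : {set {set gT}} := classes G :\ [1 gT].

(* The graph is simple, hence the condition C != D. For vertices C and D it
   only matters if G is cyclic, since a loop at x ^: G would mean <[x]> = G.
   By lambda_adjE the choice of representatives is irrelevant. *)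
Definition lambda_adj (C D : {set gT}) : bool :=
  [&& C \in lambda_vertices, D \in lambda_vertices, C != D &
      [exists x in C, exists y in D, invariably_generates G [set x; y]]].

Definition lambda_isolated : {set {set gT}} :=
  [set C in lambda_vertices | [forall D, ~~ lambda_adj C D]].

Lemma invariably_generates_conj x y a b :
  a \in G -> b \in G -> x ^: G != y ^: G ->
  invariably_generates G [set x; y] ->
  invariably_generates G [set x ^ a; y ^ b].
Proof.
move=> aG bG nxy /andP[sXG /forallP gen].
have xG : x \in G by apply: (subsetP sXG); rewrite set21.
have yG : y \in G by apply: (subsetP sXG); rewrite set22.
have nyx : (y == x) = false by apply: contraNF nxy => /eqP->.
apply/andP; split; first by rewrite subUset !sub1set !groupJ.
apply/forallP => g; apply/implyP => /forall_inP gG.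
pose h := [ffun z => if z == x then a * g (x ^ a) else b * g (y ^ b)].
have /implyP := gen h; rewrite !imsetU1 !imset_set1 !ffunE eqxx nyx !conjgM.
apply; apply/forall_inP => z _; rewrite ffunE.
by case: ifP => _; rewrite groupM // gG // ?set21 ?set22.
Qed.

Lemma lambda_adjE x y : x \in G^# -> y \in G^# -> x ^: G != y ^: G ->
  lambda_adj (x ^: G) (y ^: G) = invariably_generates G [set x; y].
Proof.
move=> /setD1P[x1 xG] /setD1P[y1 yG] nxy.
have vtx z : z != 1 -> z \in G -> z ^: G \in lambda_vertices.
  by move=> z1 zG; rewrite !inE mem_classes // andbT classG_eq1.
rewrite /lambda_adj !vtx // nxy /=; apply/idP/idP; last first.
  by move=> gen; apply/exists_inP; exists x; rewrite ?class_refl //;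
     apply/exists_inP; exists y; rewrite ?class_refl.
case/exists_inP=> _ /imsetP[a aG ->] /exists_inP[_ /imsetP[b bG ->]] gen.
rewrite -(conjgK a x) -(conjgK b y).
by apply: invariably_generates_conj; rewrite ?groupV // !classGidl.
Qed.

End InvariablyGeneratingGraph.

(* Main.v *)
Require Import Defs.
From mathcomp Require Import all_boot all_fingroup all_solvable.
From mathcomp Require Import all_algebra all_field zify.
From mathcomp Require Import filter.

(** Identify the n points of the projective space P(F_q^d) with [0, n). Let U be
the nilpotent shift of F_q^d and let x_s be the permutation of the points induced
by 1 + U^s, where s is even and d/2 <= s < d, so that (U^s)^2 = 0. Then x_s has
order p, the characteristic, and at least q fixed points, hence it stabilizes
subsets of every size. If y is not an n-cycle, then suitable conjugates of x_s and
y stabilize a common proper nonempty subset; if y is an n-cycle, then it is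
conjugate to a Singer cycle, and both lie in the group of collineations, which
does not contain A_n. Since x_s commutes with an odd transposition, conjugation in
S_n may be replaced by conjugation in A_n, so the class of x_s is isolated. The
number of fixed points of x_s increases strictly with s, which gives about d/4
isolated classes. *)

Set Implicit Arguments.
Unset Strict Implicit.
Unset Printing Implicit Defensive.

(** * Permutations of a finite set, their invariant subsets, and a criterion for isolated classes of
    the alternating group *)

Section Permutations.
Local Open Scope group_scope.
Variable T : finType.
Implicit Types (s t x y c : {perm T}) (A B : {set T}) (a b u v : T).

Lemma astabs_permP A s :
  reflect (forall a, (s a \in A) = (a \in A)) (s \in 'N(A | 'P)).
Proof.
apply: (iffP idP) => [/astabs_act As a | As]; first exact: As.
by rewrite !inE /=; apply/subsetP => a; rewrite !inE /= apermE As.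
Qed.

Lemma card_lt_notin A : #|A| < #|T| -> exists b, b \notin A.
Proof.
rewrite -subn_gt0 -[#|A|](congr1 (fun B : {set T} => #|B|) (setCK A)) -cardsCs.
by case/card_gt0P=> b; rewrite inE; exists b.
Qed.

Lemma porbit_astabs s u : s \in 'N(porbit s u | 'P).
Proof.
apply/astabs_permP => a; rewrite -!eq_porbit_mem ![_ == porbit s u]eq_sym.
by have := porbit_perm s 1 a; rewrite expg1 => ->.
Qed.

Lemma odd_permX s n : odd_perm (s ^+ n) = odd n && odd_perm s.
Proof.
elim: n => [|n IHn]; first by rewrite odd_perm1.
by rewrite expgS odd_permM IHn oddS; case: (odd n); case: (odd_perm s).
Qed.

(** Induction on [#|A :\: B|]: swapping a point of [A :\: B] with one of [B :\: A] preserves the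
    cardinality of [A] and shrinks the difference. *)
Lemma perm_imset_eqcard A B : #|A| = #|B| -> exists t : {perm T}, t @: A = B.
Proof.
have [k] := ubnP #|A :\: B|; elim: k A => // k IHk A ltABk eqAB.
have [sAB | /subsetPn[a Aa B'a]] := boolP (A \subset B).
  exists 1; rewrite (_ : _ @: A = A); first by apply/eqP; rewrite eqEcard sAB eqAB leqnn.
  by rewrite -[RHS]imset_id; apply: eq_imset => z; rewrite perm1.
have /subsetPn[b Bb A'b]: ~~ (B \subset A).
  by apply: contra B'a => sBA; rewrite (eqP (_ : B == A)) // eqEcard sBA eqAB leqnn.
have cardtA: #|tperm a b @: A| = #|A| by rewrite card_imset //; apply: perm_inj.
have [] := IHk (tperm a b @: A); last 1 first.
- move=> t tAB; exists (tperm a b * t); rewrite -tAB -imset_comp.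
  by apply: eq_imset => z; rewrite permM.
- have Ea: a \in A :\: B by rewrite inE B'a.
  apply: (@leq_trans #|A :\: B|); last by [].
  rewrite [X in _ < X](cardsD1 a) Ea ltnS; apply: subset_leq_card.
  apply/subsetP => z; rewrite !inE => /andP[B'z /imsetP[w Aw Dz]].
  rewrite {z}Dz in B'z *; case: tpermP B'z => [_|Dw|/eqP nwa _ B'w].
  - by rewrite Bb.
  - by rewrite Dw (negPf A'b) in Aw.
  by rewrite nwa B'w Aw.
- by rewrite cardtA.
Qed.


(** Two cycles of full length are conjugate: a conjugating permutation sends [(c ^+ j) u] to
    [(y ^+ j) u], which is well defined because both depend exactly on [j] modulo [n]. *)
Lemma transitive_perm_conj c y u :
    (forall v, v \in porbit c u) -> (forall v, v \in porbit y u) ->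
  exists t, c ^ t = y.
Proof.
move=> tr_c tr_y; set n := #|T|.
have cardT s : (forall v, v \in porbit s u) -> #|porbit s u| = n.
  by move=> tr; apply: eq_card => v; rewrite tr.
have n_gt0 : 0 < n by apply/card_gt0P; exists u.
have modX s j : (forall v, v \in porbit s u) -> (s ^+ (j %% n)) u = (s ^+ j) u.
  move=> tr; rewrite [in RHS](divn_eq j n) addnC expgD permM mulnC expgM.
  elim: (j %/ n) => [|k IHk]; first by rewrite perm1.
  rewrite expgSr permM -IHk -!permM -expgD addnC expgD permM.
  by rewrite [(s ^+ n) u]permX -(cardT _ tr) iter_porbit.
(* The discrete logarithm of [v]: the exponent [j < n] with [(s ^+ j) u = v]. *)
pose idx s v := index v (traject s u n).
have idxE s j : (forall v, v \in porbit s u) -> idx s ((s ^+ j) u) = j %% n.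
  move=> tr; have lt_jn : j %% n < n by rewrite ltn_mod.
  rewrite -modX // permX -(nth_traject s lt_jn) /idx -(cardT s tr).
  by rewrite index_uniq ?size_traject ?uniq_traject_porbit // (cardT s tr).
pose f s s' v := ((s' ^+ idx s v) u).
have fK s s' : (forall v, v \in porbit s u) -> (forall v, v \in porbit s' u) ->
    cancel (f s s') (f s' s).
  move=> tr tr' v; have /porbitP[j ->] := tr v.
  by rewrite /f idxE // modX // idxE // modX.
have injf : injective (f c y) by apply: can_inj (fK _ _ tr_c tr_y).
exists (perm injf); apply/permP => w; rewrite -[w](permKV (perm injf)) permJ.
have /porbitP[j ->] := tr_c ((perm injf)^-1 w).
by rewrite -[c _]permM -expgSr !permE /f !idxE // !modX // expgSr permM.
Qed.

(* Greedily: adjoin a fixed point, or else trade p - 1 fixed points for a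
   p-cycle. *)
Lemma prime_exponent_astabs_card x p k :
    prime p -> x ^+ p = 1 -> p.-1 <= #|[set u | x u == u]| -> k <= #|T| ->
  exists2 A : {set T}, #|A| = k & x \in 'N(A | 'P).
Proof.
move=> p_pr xp1 leF; pose F := [set u | x u == u].
have [D cardD sDF] : exists2 D : {set T}, #|D| = p.-1 & D \subset F.
  exists [set z in take p.-1 (enum F)].
    rewrite cardsE (card_uniqP _) ?take_uniq ?enum_uniq // size_takel //.
    by rewrite -cardE.
  by apply/subsetP => z; rewrite inE => /mem_take; rewrite mem_enum.
have porb u : x u != u -> #|porbit x u| = p.
  move=> xu; have : #|porbit x u| %| p.
    rewrite porbitE; apply: dvdn_trans (dvdn_orbit _ _ _) _.
    by rewrite -orderE order_dvdn xp1.
  have [/eqP c1 _|c1] := eqVneq #|porbit x u| 1%N; last first.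
    by move/(prime_nt_dvdP p_pr c1).
  have /cards1P[v Du] : #|porbit x u| == 1%N by rewrite c1.
  have := porbit_id x u; have := mem_porbit x 1 u.
  by rewrite Du !inE expg1 => /eqP xuv /eqP uv; rewrite xuv uv eqxx in xu.
elim: k => [_|k IHk lt_kT].
  by exists set0; rewrite ?cards0 //; apply/astabs_permP => a; rewrite !inE.
have [A cardA /astabs_permP sA] := IHk (ltnW lt_kT).
have [sFA | /subsetPn[b]] := boolP (F \subset A); last first.
  rewrite inE => /eqP xb A'b; exists (b |: A); first by rewrite cardsU1 A'b cardA.
  apply/astabs_permP => a; rewrite !inE sA.
  by rewrite -{1}xb (inj_eq perm_inj).
have [b A'b] := card_lt_notin (eq_ind_r (fun m => m < _) lt_kT cardA).
have F'b : x b != b by apply: contra A'b => xb; rewrite (subsetP sFA) ?inE.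
have O'A : [disjoint A :\: D & porbit x b].
  rewrite disjoint_subset; apply/subsetP => z; rewrite !inE => /andP[_ Az].
  apply: contra A'b => /porbitP[i Dz]; rewrite {z}Dz in Az.
  elim: i Az => [|i IHi]; first by rewrite perm1.
  by rewrite expgSr permM sA.
exists (A :\: D :|: porbit x b).
  rewrite cardsU disjoint_setI0 // cards0 subn0 porb // cardsD.
  rewrite (setIidPr (subset_trans sDF sFA)) cardD -[X in _ + X](prednK (prime_gt0 p_pr)).
  rewrite addnS subnK ?cardA // -cardD -cardA.
  exact: subset_leq_card (subset_trans sDF sFA).
have /astabs_permP sO := porbit_astabs x b.
apply/astabs_permP => a; rewrite !in_setU !in_setD sA sO; congr (~~ _ && _ || _).
have fixD z : z \in D -> x z = z by move/(subsetP sDF); rewrite inE => /eqP.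
apply/idP/idP => [Dxa|/[dup]/fixD-> //].
by rewrite -(perm_inj (fixD _ Dxa)).
Qed.

(** A 3-cycle through a point [b] of [B], a point [c] outside and any third point [d] cannot
    preserve [B]. *)
Lemma Alt_not_astabs B : 2 < #|T| -> 0 < #|B| < #|T| ->
  ~~ ('Alt_T \subset 'N(B | 'P)).
Proof.
move=> T3 /andP[/card_gt0P[b Bb] ltBT].
have [c B'c] := card_lt_notin ltBT.
have bc : b != c by apply: contraNneq B'c => <-.
have [d] : exists d, d \in ~: [set b; c].
  by apply/card_gt0P; rewrite cardsCs setCK subn_gt0 cards2 bc.
rewrite !inE negb_or => /andP[db dc].
apply/subsetPn; exists (tperm b c * tperm c d).
  by rewrite Alt_even odd_permM !odd_tperm bc eq_sym dc.
have [Bd | B'd] := boolP (d \in B).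
  apply/astabs_permP => /(_ c).
  rewrite permM tpermR tpermD ?Bb ?(negPf B'c) // eq_sym //.
apply/astabs_permP => /(_ b).
by rewrite permM tpermL tpermL Bb (negPf B'd).
Qed.

(** The transposition of two fixed points of [x] centralizes [x], so it can correct the parity of
    [s] without changing the conjugate. *)
Lemma Alt_conj x s a b : a != b -> x a = a -> x b = b ->
  exists2 t : {perm T}, t \in 'Alt_T & x ^ s = x ^ t.
Proof.
move=> ab xa xb; have xt : x ^ tperm a b = x.
  have tx : tperm a b ^ x = tperm a b by rewrite tpermJ xa xb.
  by rewrite conjgE -[X in x * X]tx -conjgC mulKg.
have [odd_s | even_s] := boolP (odd_perm s); last by exists s; rewrite ?Alt_even.
exists (tperm a b * s); last by rewrite conjgM xt.
by rewrite Alt_even odd_permM odd_tperm ab odd_s.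
Qed.

Lemma isolated_in_Alt x c (H : {group {perm T}}) a b :
    x \in 'Alt_T -> x != 1 -> a != b -> x a = a -> x b = b ->
    (forall k, k <= #|T| ->
       exists2 A : {set T}, #|A| = k & x \in 'N(A | 'P)) ->
    x \in H -> c \in H -> (forall u v, v \in porbit c u) ->
    ~~ ('Alt_T \subset H) ->
  x ^: 'Alt_T \in lambda_isolated 'Alt_T%G.
Proof.
move=> Ax x1 ab xa xb stab Hx Hc tr_c H'A.

have vx : x ^: 'Alt_T \in lambda_vertices 'Alt_T%G.
  by rewrite !inE mem_classes // classG_eq1 x1.
rewrite inE vx. apply/forallP => D; apply/negP => adj.
have /and4P[_ /setD1P[y1 /imsetP[y Ay DD]] xD _] := adj.
rewrite DD in y1 xD adj.
have ny1 : y != 1 by apply: contraNneq y1 => ->; rewrite class1G.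
rewrite lambda_adjE ?in_setD1 ?x1 ?ny1 // in adj.
have T3 : 2 < #|T|.
  rewrite ltnNge; apply: contra x1 => T2.
  by rewrite -[x == 1]in_set1 -set1gE -(trivial_Alt_2 T2).
(* A common proper overgroup of x and y up to conjugacy rules out adjacency. *)
suffices [s [K [Ks Ky K'A]]] : exists s (K : {group {perm T}}),
    [/\ x ^ s \in K, y \in K & ~~ ('Alt_T \subset K)].
  have [t At xst] := Alt_conj s ab xa xb.
  have /andP[_ /forallP/(_ [ffun z => if z == x then t else 1])] := adj.
  move/implyP=> gen; case/negP: K'A; rewrite -(eqP (gen _)) => [|/=]; last first.
    by apply/forall_inP => z _; rewrite ffunE; case: ifP; rewrite ?group1.
  rewrite gen_subG; apply/subsetP => _ /imsetP[z /set2P[] -> ->]; rewrite ffunE.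
    by rewrite eqxx -xst.
  by case: (y =P x) xD => [->|_ _]; rewrite ?eqxx // conjg1.
have [/existsP[u /eqP O_u]|no_cyc] := boolP [exists u, porbit y u == setT].
  have [//|v|s <-] := @transitive_perm_conj c y u; first by rewrite O_u inE.
  (* Here [y] is the conjugate of [c] by [s]. Normality of the alternating group keeps it from lying
     in [H :^ s]. *)
  exists s, (H :^ s)%G; rewrite /= !memJ_conjg Hx Hc; split=> //.
  apply: contra H'A; rewrite -(conjSg _ _ s^-1) conjsgK.
  by rewrite (normsP (Alt_norm T)) // inE.
(* Since [y] is not a full cycle, its orbit [B] is a proper invariant subset. An [x]-invariant set
   of the same size can be carried onto [B], and the setwise stabilizer of [B] is the required
   group. *)
pose B := porbit y a; have B_T : 0 < #|B| < #|T|.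
  rewrite lt0n card_porbit_neq0 ltnNge -cardsT; apply: contra no_cyc => leTB.
  by apply/existsP; exists a; rewrite eqEcard subsetT.
have [A cardA xA] := stab #|B| (max_card _).
have [s sA] := perm_imset_eqcard cardA.
exists s, 'N(B | 'P)%G; rewrite /= porbit_astabs Alt_not_astabs //; split=> //.
apply/astabs_permP => z; rewrite -[z](permKV s) permJ -sA !mem_imset; try exact: perm_inj.
by move/astabs_permP: xA.
Qed.
End Permutations.

Section FiniteGeometry.
Import GRing.Theory.
Local Open Scope group_scope.
Local Open Scope ring_scope.

(** * Powers of the nilpotent shift, and elements of square zero *)

Section Shift.
Variables (F : fieldType) (e : nat).
Local Notation d := e.+1.

(** This is [U ^+ s] written entrywise: on row vectors it sends the basis vector of index [i] to
    that of index [i + s], or to 0 once [i + s] reaches [d]. *)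
Definition shiftmx s : 'M[F]_d := \matrix_(i, j) (j == i + s :> nat)%N%:R.

Lemma shiftmx_mul s t : shiftmx s * shiftmx t = shiftmx (s + t).
Proof.
apply/matrixP => i k; rewrite !mxE.
have [lt_d | ge_d] := ltnP (i + s) d; last first.
  rewrite big1 => [|j _]; last first.
    by rewrite !mxE (ltn_eqF (leq_trans (ltn_ord j) ge_d)) mul0r.
  by rewrite addnA ltn_eqF // (leq_trans (ltn_ord k)) // (leq_trans ge_d) ?leq_addr.
rewrite (bigD1 (Ordinal lt_d)) //= big1 => [|j ne_j]; last first.
  by rewrite !mxE -(inj_eq val_inj) /= in ne_j *; rewrite (negPf ne_j) mul0r.
by rewrite !mxE eqxx mul1r addr0 addnA.
Qed.

Lemma shiftmx_eq0 s : (d <= s)%N -> shiftmx s = 0.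
Proof.
move=> ds; apply/matrixP => i j; rewrite !mxE ltn_eqF //.
by rewrite (leq_trans (ltn_ord j)) // (leq_trans ds) ?leq_addl.
Qed.

Lemma delta_shiftmx_eq0 (i : 'I_d) s :
  (delta_mx 0 i *m shiftmx s == 0 :> 'rV_d) = (d <= i + s)%N.
Proof.
rewrite -rowE; apply/eqP/idP => [/rowP row0 | dis]; last first.
  by apply/rowP => j; rewrite !mxE ltn_eqF // (leq_trans (ltn_ord j)).
rewrite leqNgt; apply/negP => lt_d; have := row0 (Ordinal lt_d).
by rewrite !mxE eqxx => /eqP; rewrite oner_eq0.
Qed.

End Shift.

Section SquareZero.
Variables (R : pzRingType) (N : R).
Hypothesis N2 : N * N = 0.

Lemma exp1D_sqr0 m : (1 + N) ^+ m = 1 + N *+ m.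
Proof.
elim: m => [|m IHm]; first by rewrite expr0 mulr0n addr0.
by rewrite exprSr IHm mulrDr mulr1 mulrDl mul1r mulrnAl N2 mul0rn addr0 mulrSr -addrA.
Qed.
End SquareZero.

(** * Projective points, given by representing row vectors, and the permutations that matrices
    induce on them *)

Section ProjectivePoints.
Variables (F : finFieldType) (e n : nat) (pt : 'I_n -> 'rV[F]_e.+1).
Local Notation d := e.+1.
Implicit Types (u v w : 'rV[F]_d) (g h : 'M[F]_d) (s t : {perm 'I_n}).
Hypothesis pt_neq0 : forall i, pt i != 0.
Hypothesis pt_inj : forall i j, (pt i <= pt j)%MS -> i = j.
Hypothesis pt_surj : forall v, v != 0 -> exists i, (v <= pt i)%MS.

Lemma rV_submx_sym u v : u != 0 -> (u <= v)%MS -> (v <= u)%MS.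
Proof.
move=> u0 /sub_rVP[a Du]; have a0 : a != 0.
  by apply: contraNneq u0 => a0; rewrite Du a0 scale0r.
by rewrite Du eqmx_scale.
Qed.

Lemma rV_mulmx_unit_neq0 u g : g \in unitmx -> u != 0 -> u *m g != 0.
Proof.
move=> gU; apply: contraNneq => ug0.
by rewrite -(mulmxK gU u) ug0 mul0mx.
Qed.

(** For nonzero row vectors, inclusion of the spanned lines is already equality, so it expresses
    that two vectors represent the same point. *)
Definition induces g s := forall i, (pt i *m g <= pt (s i))%MS.

Lemma induces_ex g : g \in unitmx -> exists s, induces g s.
Proof.
move=> gU; have /fin_all_exists[f fP] i : exists j, (pt i *m g <= pt j)%MS.
  by apply/pt_surj/rV_mulmx_unit_neq0.
have injf : injective f.
  move=> i j eq_f; apply: pt_inj; rewrite -(mulmxK gU (pt i)) -(mulmxK gU (pt j)).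
  apply/submxMr/(submx_trans (fP i)); rewrite eq_f.
  by apply: rV_submx_sym (fP j); apply: rV_mulmx_unit_neq0.
by exists (perm injf) => i; rewrite permE.
Qed.

Lemma induces_uniq g s t : g \in unitmx -> induces g s -> induces g t -> s = t.
Proof.
move=> gU gs gt; apply/permP => i; apply: pt_inj; apply: submx_trans (gt i).
by apply: rV_submx_sym (gs i); apply: rV_mulmx_unit_neq0.
Qed.

Lemma inducesM g h s t : induces g s -> induces h t -> induces (g *m h) (s * t)%g.
Proof.
move=> gs ht i; rewrite permM mulmxA; apply: submx_trans (ht _).
exact: submxMr.
Qed.

Lemma induces1 : induces 1%:M 1%g.
Proof. by move=> i; rewrite mulmx1 perm1. Qed.

Lemma inducesX g s m : induces g s -> induces (g ^+ m) (s ^+ m)%g.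
Proof.
move=> gs; elim: m => [|m IHm]; first exact: induces1.
by rewrite exprSr expgSr; apply: inducesM.
Qed.

(** Preserving collinearity in one direction suffices: in a finite group, closure under products
    gives inverses. *)
Definition collineations : {set {perm 'I_n}} :=
  [set s : {perm 'I_n} | [forall i, forall j, forall k,
     (pt k <= pt i + pt j)%MS ==> (pt (s k) <= pt (s i) + pt (s j))%MS]].

Lemma collineationsP s :
  reflect (forall i j k, (pt k <= pt i + pt j)%MS ->
             (pt (s k) <= pt (s i) + pt (s j))%MS) (s \in collineations).
Proof.
rewrite inE; apply: (iffP 'forall_'forall_'forall_implyP) => H i j k; exact: H.
Qed.

Lemma collineations_group_set : group_set collineations.
Proof.
apply/group_setP; split=> [|s t /collineationsP sC /collineationsP tC].
  by apply/collineationsP => i j k; rewrite !perm1.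
by apply/collineationsP => i j k ijk; rewrite !permM; apply/tC/sC.
Qed.
Canonical collineations_group := Group collineations_group_set.

Lemma induces_collineation g s :
  g \in unitmx -> induces g s -> s \in collineations.
Proof.
move=> gU gs; apply/collineationsP => i j k ijk.
have sg l : (pt (s l) <= pt l *m g)%MS.
  by apply: rV_submx_sym (gs l); apply: rV_mulmx_unit_neq0.
apply: submx_trans (sg k) _; apply: submx_trans (submxMr g ijk) _.
by rewrite addsmxMr addsmxS.
Qed.

(** The points span the whole space, since every nonzero row of the identity matrix is represented
    by one of them. *)
Lemma exists_pt_notin (W : 'M[F]_d) : (\rank W < d)%N -> exists i, ~~ (pt i <= W)%MS.
Proof.
move=> rW; apply/existsP; rewrite -negb_forall; apply: contraL rW => /forallP ptW.
rewrite -leqNgt -[X in (X <= _)%N](mxrank1 F d); apply: mxrankS.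
apply/row_subP => i; set v := row i _.
have [->|/pt_surj[j vj]] := eqVneq v 0; first exact: sub0mx.
exact: submx_trans vj (ptW j).
Qed.

(* A double transposition swapping two points of a line and moving a third one
   off that line is not a collineation. *)
Lemma Alt_not_collineations : (2 < d)%N -> ~~ ('Alt_('I_n) \subset collineations).
Proof.
move=> d3; have rk1 u : (\rank u <= 1)%N := rank_leq_row u.
have [i _] := @exists_pt_notin 0 ltac:(by rewrite mxrank0).
have [j] : exists j, ~~ (pt j <= <<pt i>>)%MS.
  by apply: exists_pt_notin; rewrite genmxE (leq_ltn_trans (rk1 _)) // ltnW.
rewrite genmxE => nji; have ij : i != j by apply: contraNneq nji => ->.
have [l nl] : exists l, ~~ (pt l <= pt i + pt j)%MS.
  apply: exists_pt_notin; apply: leq_ltn_trans (mxrank_adds_leqif _ _) _.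
  by apply: leq_ltn_trans d3; apply: (leq_add (rk1 _) (rk1 _)).
have v0 : pt i + pt j != 0.
  by rewrite addr_eq0; apply: contraNneq nji => ->; rewrite eqmx_opp.
have [k vk] := pt_surj v0.
have kij : (pt k <= pt i + pt j)%MS.
  by apply: submx_trans (rV_submx_sym v0 vk) _; rewrite addmx_sub_adds.
have ki : k != i.
  apply: contraNneq nji => Dk; rewrite Dk in vk.
  by rewrite -(addKr (pt i) (pt j)) addmx_sub ?eqmx_opp.
have kj : k != j.
  apply: contraNneq nji => Dk; rewrite Dk in vk; apply: rV_submx_sym => //.
  by rewrite -(addrK (pt j) (pt i)) addmx_sub ?eqmx_opp.
have off m : (pt m <= pt i + pt j)%MS -> l != m.
  by move=> ijm; apply: contraNneq nl => ->.
have [li lj] := (off i (addsmxSl _ _), off j (addsmxSr _ _)).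
apply/subsetPn; exists (tperm i j * tperm k l)%g.
  by rewrite Alt_even odd_permM !odd_tperm ij eq_sym (off k kij).
apply/collineationsP => /(_ i j k kij).
have [ik jk] : i != k /\ j != k by rewrite ![_ == k]eq_sym.
rewrite !permM tpermL tpermR (tpermD ik jk) tpermL !(@tpermD _ k l) ?(eq_sym k) //.
apply/negP; apply: contra nl => /submx_trans-> //.
by rewrite addsmx_sub addsmxSl addsmxSr.
Qed.

(** * Permutations induced by [1 + N] with [N] of square zero *)

Section Unipotent.
Variables (N : 'M[F]_d) (x : {perm 'I_n}).
Hypotheses (N2 : N * N = 0) (Nx : induces (1 + N) x).

Lemma unitmx1D_sqr0 : 1 + N \in unitmx.
Proof.
have : (1 + N) *m (1 - N) = 1%:M.
  by rewrite mulmxE mulrDl mul1r mulrBr mulr1 N2 subr0 subrK.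
by case/mulmx1_unit.
Qed.

(** A fixed point is spanned by an eigenvector of [N], and the only eigenvalue of a square-zero
    matrix is 0. *)
Lemma induces1D_fix i : (x i == i) = (pt i *m N == 0).
Proof.
apply/eqP/eqP => [xi | piN]; last first.
  apply: pt_inj; apply: rV_submx_sym (submx_trans _ (Nx i)) => //.
  by rewrite mulmxDr mulmx1 piN addr0.
have := Nx i; rewrite xi => /sub_rVP[a]; rewrite mulmxDr mulmx1 => Da.
have {}Da : pt i *m N = (a - 1) *: pt i by rewrite scalerBl scale1r -Da addrC addKr.
have [a1 | a1] := eqVneq (a - 1) 0; first by rewrite Da a1 scale0r.
have := congr1 (mulmx (pt i)) N2; rewrite mulmx0 -mulmxE mulmxA Da.
rewrite -scalemxAl Da scalerA => /eqP.
by rewrite scaler_eq0 mulf_eq0 (negPf a1) (negPf (pt_neq0 i)).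
Qed.

(** In characteristic [p], the power [(1 + N) ^+ p] equals [1 + N *+ p], which is 1. *)
Lemma induces1D_expp p : p \in [pchar F] -> (x ^+ p = 1)%g.
Proof.
move=> pF; have := inducesX p Nx.
have -> : (1 + N) ^+ p = 1%:M.
  rewrite exp1D_sqr0 // -mulr_natl (_ : p%:R = 0) ?mul0r ?addr0 //.
  by apply: pcharf0; rewrite pchar_lalg.
move=> x1; apply: induces_uniq x1 induces1; exact: unitmx1.
Qed.

(** The vectors [u + a *: v], for [a] in [F], lie in the kernel of [N] and represent pairwise
    distinct points. *)
Lemma card_fix_ge_field u v : u *m N = 0 -> v *m N = 0 ->
    v != 0 -> ~~ (u <= v)%MS ->
  (#|F| <= #|[set i | x i == i]|)%N.
Proof.
move=> uN vN v0 nuv; have w0 a : u + a *: v != 0.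
  by rewrite addr_eq0; apply: contraNneq nuv => ->; rewrite eqmx_opp scalemx_sub.
have /fin_all_exists[f fP] (a : F) : exists i, ((u + a *: v)%R <= pt i)%MS.
  exact: pt_surj (w0 a).
have fix_f a : f a \in [set i | x i == i].
  rewrite inE induces1D_fix; have /sub_rVP[b ->] := rV_submx_sym (w0 a) (fP a).
  by rewrite -scalemxAl mulmxDl -scalemxAl uN vN scaler0 addr0 scaler0.
have injf : injective f.
  move=> a b eq_f; have := rV_submx_sym (w0 b) (fP b); rewrite -eq_f.
  move/(submx_trans (fP a))/sub_rVP => [c Dc].
  (* Comparing [u + a *: v] with [c *: (u + b *: v)], a value [c != 1] would make [u] a multiple of
     [v]. *)
  have c1 : c = 1.
    apply/eqP; rewrite -subr_eq0; apply: contraR nuv => c1.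
    have Dcu : (c - 1) *: u = (a - c * b) *: v.
      rewrite !scalerBl scale1r; apply/eqP; rewrite subr_eq addrAC eq_sym subr_eq.
      by rewrite addrC Dc scalerDr scalerA.
    by rewrite -(eqmx_scale _ c1) Dcu scalemx_sub.
  apply/eqP; rewrite -subr_eq0; apply: contraR v0 => ab.
  move/eqP: Dc; rewrite c1 scale1r (can_eq (addKr u)) -subr_eq0 -scalerBl scaler_eq0.
  by rewrite (negPf ab).
rewrite -(card_imset _ injf); apply: subset_leq_card.
by apply/subsetP => _ /imsetP[a _ ->].
Qed.
End Unipotent.

Lemma transitive_cycle (S : 'M[F]_d) (v0 : 'rV[F]_d) c :
    v0 != 0 -> S \in unitmx -> induces S c ->
    (forall v, v != 0 -> exists k, (v <= v0 *m S ^+ k)%MS) ->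
  forall i j, j \in porbit c i.
Proof.
move=> nz_v0 SU Sc genS; have [i0 vi0] := pt_surj nz_v0.
suffices tr i : porbit c i = porbit c i0.
  by move=> i j; rewrite -eq_porbit_mem !tr.
apply/eqP; rewrite eq_porbit_mem; apply/porbitP; have [k ik] := genS _ (pt_neq0 i).
exists k; apply: pt_inj; apply: submx_trans ik (submx_trans _ (inducesX k Sc i0)).
exact: submxMr.
Qed.

Definition shift_fix (s : nat) := [set i | pt i *m shiftmx F e s == 0].

(** The inclusion is strict because the basis vector of index [d - t] is killed by the [t]-th power
    of the shift but not by the [s]-th. *)
Lemma card_shift_fix (s t : nat) : (s < t <= d)%N -> (#|shift_fix s| < #|shift_fix t|)%N.
Proof.
case/andP=> lt_st le_td; apply/proper_card/properP; split.
  apply/subsetP => i; rewrite !inE => /eqP pis.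
  by rewrite -(subnKC (ltnW lt_st)) -shiftmx_mul -mulmxE mulmxA pis mul0mx.
have lt_d : (d - t < d)%N by rewrite -subn_gt0 subKn //; apply: leq_ltn_trans lt_st.
pose v : 'rV[F]_d := delta_mx 0 (Ordinal lt_d).
have v0 : v != 0.
  by apply/eqP => /rowP/(_ (Ordinal lt_d))/eqP; rewrite !mxE !eqxx oner_eq0.
have [i vi] := pt_surj v0.
have /sub_rVP[a Di] := rV_submx_sym v0 vi.
have a0 : a != 0 by apply: contraNneq (pt_neq0 i) => a0; rewrite Di a0 scale0r.
exists i; rewrite inE Di -scalemxAl scaler_eq0 (negPf a0) delta_shiftmx_eq0 /=.
  by rewrite subnK.
by rewrite -ltnNge -ltn_subRL subKn.
Qed.

Lemma isolated_shift S v0 (t : nat) :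
    v0 != 0 -> S \in unitmx ->
    (forall v, v != 0 -> exists k, (v <= v0 *m S ^+ k)%MS) ->
    (0 < t)%N -> (t.*2 < d <= t.*2.*2)%N ->
  exists2 x : {perm 'I_n}, x ^: 'Alt_('I_n) \in lambda_isolated 'Alt_('I_n)%G
    & [set i | x i == i] = shift_fix t.*2.
Proof.
move=> nz_v0 SU genS t0 /andP[lt_d le_d]; set N := shiftmx F e t.*2.
have e2 : (2 < d)%N by lia.
have N2 : N * N = 0 by rewrite shiftmx_mul addnn shiftmx_eq0.
have NU := unitmx1D_sqr0 N2.
have [x Nx] := induces_ex NU; have [c Sc] := induces_ex SU.
have fix_x i : (x i == i) = (i \in shift_fix t.*2).
  by rewrite (induces1D_fix N2 Nx) inE.
exists x; last by apply/setP => i; rewrite inE fix_x.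
have [p p_pr pF] := finPcharP F.
have xp1 := induces1D_expp N2 Nx pF.
have le_pF : (p <= #|F|)%N.
  have := finNzRing_gt1 F; rewrite (card_pprimeChar pF).
  by case: logn => // k _; rewrite expnS leq_pmulr // expn_gt0 prime_gt0.
(* The last two basis vectors are killed by [N], because it shifts by [t.*2], which is at least
   2. *)
have Fix : (#|F| <= #|[set i | x i == i]|)%N.
  have lt_e : (e.-1 < d)%N by rewrite ltnS leq_pred.
  pose u : 'rV[F]_d := delta_mx 0 ord_max; pose v : 'rV[F]_d := delta_mx 0 (Ordinal lt_e).
  apply: (card_fix_ge_field N2 Nx (u := u) (v := v)); first 1 last.
  - by apply/eqP; rewrite delta_shiftmx_eq0 /=; lia.
  - by apply/eqP => /rowP/(_ (Ordinal lt_e))/eqP; rewrite !mxE !eqxx oner_eq0.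
  - apply/negP => /sub_rVP[a /rowP/(_ ord_max)/eqP].
    rewrite !mxE !eqxx -(inj_eq val_inj) /= gtn_eqF ?ltn_predL ?mulr0 ?oner_eq0 //.
    by lia.
  by apply/eqP; rewrite delta_shiftmx_eq0 /=; lia.
have [a [b [/= ab xa xb]]] : exists a b, [/\ a != b, x a = a & x b = b].
  have /card_gt1P[a [b [xa xb ab]]] := leq_trans (finNzRing_gt1 F) Fix.
  by rewrite !inE in xa xb; exists a, b; split=> //; apply/eqP.
have even_x : x \in 'Alt_('I_n).
  (* For odd [p], [x] is even because its [p]-th power is 1. For [p = 2], it is a square: [1 + N] is
     the square of [1 + shiftmx F e t], the cross term vanishing. This is why the shift is by the
     even number [t.*2]. *)
  rewrite Alt_even; have [p2 | p_odd] := even_prime p_pr; last first.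
    by have := odd_permX x p; rewrite xp1 odd_perm1 p_odd /= => <-.
  have sqN : (1 + shiftmx F e t) ^+ 2 = 1 + N.
    rewrite expr2 mulrDl mul1r mulrDr mulr1 shiftmx_mul addnn addrA.
    by rewrite -(addrA 1) -mulr2n -mulr_natl -p2 pcharf0 ?pchar_lalg // mul0r addr0.
  have tU : 1 + shiftmx F e t \in unitmx.
    by move: NU; rewrite -sqN expr2 -mulmxE unitmx_mul => /andP[].
  have [y ty] := induces_ex tU; have := inducesX 2 ty; rewrite sqN => y2.
  by rewrite (induces_uniq NU Nx y2) odd_permX.
apply: (@isolated_in_Alt _ x c collineations_group a b) => //=.
(* If [x] were 1, every point would lie in [shift_fix t.*2], which has strictly fewer points than
   [shift_fix d]. *)
- apply/eqP => x1; have := @card_shift_fix t.*2 d; rewrite lt_d leqnn => /(_ isT).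
  rewrite ltnNge; apply/negP; rewrite negbK; apply: subset_leq_card.
  by apply/subsetP => i _; rewrite -fix_x x1 perm1.
- move=> k; apply: prime_exponent_astabs_card p_pr xp1 _.
  by apply: leq_trans Fix; apply: leq_trans le_pF; apply: leq_pred.
- exact: induces_collineation Nx.
- exact: induces_collineation Sc.
- exact: transitive_cycle Sc genS.
exact: Alt_not_collineations.
Qed.
End ProjectivePoints.

(** * Extensions of finite fields and Singer cycles *)

(** The extension is the splitting field of ['X^m - 'X] with [m = q ^ d]. Its elements are exactly
    the [m] distinct roots, and counting them yields the dimension. *)
Lemma finField_ext_dim (F : finFieldType) d : (0 < d)%N ->
  exists L : fieldExtType F, \dim {:L} = d.
Proof.
move=> d_gt0; set q := #|F|; set m := (q ^ d)%N.
have q_gt1 : (1 < q)%N := finNzRing_gt1 F.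
have m_gt1 : (1 < m)%N by rewrite (ltn_exp2l 0).
pose f (R : nzRingType) : {poly R} := 'X^m - 'X.
have Df R : f R = ('X^(m.-1) - 1) * ('X - 0).
  by rewrite subr0 mulrBl mul1r -exprSr prednK // ltnW.
have m1_gt0 : (0 < m.-1)%N by rewrite -ltnS prednK // ltnW.
have /FinSplittingFieldFor[/= L [zs DfL defL]] : f F != 0.
  by rewrite Df monic_neq0 ?rpredM ?monicXsubC ?monicXnsubC.
rewrite rmorphB rmorphXn /= map_polyX -/(f L) in DfL.
have [p p_pr pF] := finPcharP F; have pL : p \in [pchar L] by rewrite pchar_lalg.
have q0 : q%:R = 0 :> L.
  have := q_gt1; rewrite /q (card_pprimeChar pF).
  by case: logn => // k _; rewrite natrX pcharf0 // expr0n.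
have m0 : m%:R = 0 :> L by rewrite natrX q0 expr0n gtn_eqF.
(* The factor ['X^(m.-1) - 1] is separable because [m.-1] is -1 in [L], and 0 is not a root of
   it. *)
have Uzs : uniq zs.
  rewrite -separable_prod_XsubC -(eqp_separable DfL) Df separable_root andbC.
  rewrite /root !hornerE subr_eq0 eq_sym expr0n gtn_eqF ?oner_eq0 //=.
  rewrite cyclotomic.separable_Xn_sub_1 // -subn1 natrB 1?ltnW // subr_eq0.
  by rewrite m0 eq_sym oner_eq0.
have /finField_galois_generator[/= a _ Da] : (1 <= {:L})%VS by apply: sub1v.
rewrite dimv1 expn1 -/q in Da; pose E := fixedSpace (a ^+ d)%g.
(* [a] is the Frobenius map, so the roots are the fixed points of its [d]-th power. Hence they form
   a subfield, which is all of [L] since the roots generate [L]. *)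
have in_zs : zs =i E.
  move=> z; rewrite -root_prod_XsubC -(eqp_root DfL) (sameP fixedSpaceP eqP).
  rewrite /root !hornerE subr_eq0 /= /m; congr (_ == z).
  elim: (d) => [|i IHi]; first by rewrite gal_id.
  by rewrite expgSr expnSr exprM IHi galM ?Da ?memvf.
have defE : E = {:L}%VS.
  apply/eqP; rewrite eqEsubv subvf -defL -[E]subfield_closed agenvS //.
  by rewrite subv_add sub1v; apply/span_subvP => z; rewrite in_zs.
exists L; apply: (expnI q_gt1); rewrite -/m.
have <- : #|FinFieldExtType L| = m.
  have /eq_card-> : FinFieldExtType L =i zs by move=> z; rewrite in_zs defE memvf.
  apply: succn_inj; rewrite (card_uniqP _) //= -(size_prod_XsubC _ id).
  by rewrite -(eqp_size DfL) size_polyDl size_polyXn // size_polyN size_polyX.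
by rewrite -(@card_vspace F (FinFieldExtType L) _ (fullv : {vspace L})) card_vspacef.
Qed.

(** The [N] nonzero elements are all [N]-th roots of unity, so one of them is primitive. *)
Lemma finField_cyclic (K : finFieldType) :
  exists2 w : K, w != 0 & forall z, z != 0 -> exists k, z = w ^+ k.
Proof.
have q_gt1 := finNzRing_gt1 K; set N := #|K|.-1.
have N_gt0 : (0 < N)%N by rewrite -ltnS prednK // ltnW.
have rootN (z : K) : z != 0 -> z ^+ N = 1.
  by move=> z0; apply: (mulIf z0); rewrite -exprSr prednK ?expf_card ?mul1r // ltnW.
pose rs := [seq z <- enum K | z != 0].
have rsN : all N.-unity_root rs.
  by apply/allP => z; rewrite mem_filter unity_rootE => /andP[/rootN-> _].
have size_rs : (N <= size rs)%N.
  rewrite /N -(cardC1 (0 : K)) cardE; apply: uniq_leq_size (enum_uniq _) _ => z.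
  by rewrite mem_enum mem_filter mem_enum !inE andbT.
have /hasP[w _ prim_w] := has_prim_root N_gt0 rsN (filter_uniq _ (enum_uniq K)) size_rs.
exists w => [|z /rootN z1]; last first.
  by have [k ->] := prim_rootP prim_w z1; exists k.
apply/eqP => w0; have /eqP := prim_expr_order prim_w.
by rewrite w0 expr0n gtn_eqF // eq_sym oner_eq0.
Qed.

(** [S] is multiplication by a generator [w] of the multiplicative group of the extension [L] of
    degree [e.+1]. As [w ^+ n] is a scalar, exponents below [n] already reach every point. *)
Lemma singer_matrix (F : finFieldType) e n :
    (#|F| ^ e.+1 - 1 = n * (#|F| - 1))%N ->
  exists (S : 'M[F]_e.+1) (v0 : 'rV[F]_e.+1), [/\ v0 != 0, S \in unitmx &
    forall v : 'rV_e.+1, v != 0 -> exists i : 'I_n, (v <= v0 *m S ^+ i)%MS].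
Proof.
move=> Dn; have q_gt1 := finNzRing_gt1 F.
have n_gt0 : (0 < n)%N.
  have : (0 < #|F| ^ e.+1 - 1)%N by rewrite subn_gt0 (ltn_exp2l 0).
  by rewrite Dn muln_gt0 => /andP[].
have [L dimL] := finField_ext_dim F (ltn0Sn e).
have [w w0 gen_w] : exists2 w : L, w != 0 & forall z : L, z != 0 -> exists k, z = w ^+ k.
  exact: finField_cyclic (FinFieldExtType L).
have [b basis_b] : exists b : e.+1.-tuple L, basis_of {:L} b.
  by rewrite -dimL; exists (vbasis {:L}); apply: vbasisP.
have free_b := basis_free basis_b.
pose phi (z : L) : 'rV[F]_e.+1 := \row_i coord b i z.
pose psi (v : 'rV[F]_e.+1) : L := \sum_i v 0 i *: b`_i.
have phiK : cancel phi psi.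
  move=> z; rewrite {2}(coord_basis basis_b (memvf z)).
  by apply: eq_bigr => i _; rewrite mxE.
have psiK : cancel psi phi by move=> v; apply/rowP => i; rewrite mxE coord_sum_free.
have phi0 : phi 0 = 0 by apply/rowP => i; rewrite !mxE linear0.
have phiZ c z : phi (c *: z) = c *: phi z by apply/rowP => i; rewrite !mxE linearZ.
(* The matrix of multiplication by [z] in the basis [b], acting on row vectors. *)
pose M z : 'M[F]_e.+1 := \matrix_i phi (z * b`_i).
have mulM y z : phi y *m M z = phi (z * y).
  apply/rowP => j; rewrite !mxE {2}(coord_basis basis_b (memvf y)).
  rewrite mulr_sumr linear_sum; apply: eq_bigr => i _.
  by rewrite !mxE -scalerAr linearZ.
have mulM1 y z : y * z = 1 -> M z *m M y = 1%:M.
  move=> yz1; apply/row_matrixP => i.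
  by rewrite !rowE mulmx1 mulmxA -[delta_mx 0 i]psiK !mulM mulrA yz1 mul1r.
have mulMX k : phi 1 *m M w ^+ k = phi (w ^+ k).
  elim: k => [|k IHk]; first by rewrite !expr0 mulmx1.
  by rewrite exprSr -mulmxE mulmxA IHk mulM -exprS.
exists (M w), (phi 1); split.
- by apply/eqP => /(congr1 psi); rewrite phiK -phi0 phiK => /eqP; rewrite oner_eq0.
- by have [] := mulmx1_unit (mulM1 w^-1 w (mulVf w0)).
move=> v v0; have z0 : psi v != 0.
  by apply: contraNneq v0 => z0; rewrite -(psiK v) z0 phi0.
have wQ : w ^+ (#|F| ^ e.+1) = w.
  by apply/eqP; have := memvf w; rewrite Fermat's_little_theorem dimL.
have w1 : w ^+ (n * (#|F| - 1)) = 1.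
  apply: (mulIf w0); rewrite mul1r -exprSr -Dn subn1 prednK // expn_gt0.
  by rewrite ltnW.
(* Membership in the base field amounts to being fixed by the power map of exponent [#|F|], which
   follows from [w1]. *)
have wn : w ^+ n \in 1%VS.
  rewrite -[1%VS]/(1%AS : {vspace L}) Fermat's_little_theorem dimv1 expn1 -exprM.
  by rewrite -[X in (n * X)%N](subnK (ltnW q_gt1)) mulnDr muln1 exprD w1 mul1r.
have /vlineP[a Da] : w ^+ n \in <[1]>%VS by [].
have [k Dv] := gen_w _ z0; exists (Ordinal (ltn_pmod k n_gt0)).
rewrite mulMX /= -(psiK v) Dv {1}(divn_eq k n) mulnC exprD exprM Da.
by rewrite exprZn expr1n mulr_algl phiZ scalemx_sub.
Qed.

(** A counting argument: the [n * (#|F| - 1)] nonzero multiples of the vectors [pt i] cover all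
    [#|F| ^ e.+1 - 1] nonzero vectors, so none is obtained twice. *)
Lemma proportional_inj (F : finFieldType) e n (pt : 'I_n -> 'rV[F]_e.+1) :
    (#|F| ^ e.+1 - 1 = n * (#|F| - 1))%N ->
    (forall i, pt i != 0) ->
    (forall v : 'rV_e.+1, v != 0 -> exists i, (v <= pt i)%MS) ->
  forall i j, (pt i <= pt j)%MS -> i = j.
Proof.
move=> Dn pt0 pt_surj; pose D := setX [set: 'I_n] [set~ (0 : F)].
pose f (u : 'I_n * F) := u.2 *: pt u.1.
have /imset_injP injf : #|f @: D| == #|D|.
  have -> : f @: D = [set~ 0].
    apply/setP => v; rewrite !inE; apply/imsetP/idP => [[[i a]] | v0].
      rewrite !inE /= => a0 ->.
      by rewrite scaler_eq0 negb_or a0 pt0.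
    have [i /sub_rVP[a Dv]] := pt_surj v v0; exists (i, a) => //.
    by rewrite !inE /=; apply: contraNneq v0 => a0; rewrite Dv a0 scale0r.
  by rewrite cardsX !cardsC1 cardsT card_ord card_mx mul1n -!subn1 Dn.
move=> i j /sub_rVP[a Di].
have a0 : a != 0 by apply: contraNneq (pt0 i) => a0; rewrite Di a0 scale0r.
have : f (i, 1) = f (j, a) by rewrite /f /= scale1r.
by move/injf; rewrite !inE /= oner_eq0 a0 => /(_ isT isT)[].
Qed.

(** * Counting the isolated classes, and passage to the limit *)

Lemma many_isolated_Alt (q d n K : nat) :
    prime_power q -> n = ((q ^ d - 1) %/ (q - 1))%N -> (4 * K + 4 <= d)%N ->
  (K <= #|lambda_isolated 'Alt_('I_n)%G|)%N.
Proof.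
case=> p [k [p_pr k_gt0 Dq]] Dn leKd.
have [F pF cardF] := pPrimePowerField p_pr k_gt0; rewrite -Dq in cardF.
have q_gt1 : (1 < q)%N by rewrite -cardF finNzRing_gt1.
case: d => [|e] in Dn leKd *; first by rewrite addn4 in leKd.
have {}Dn : (#|F| ^ e.+1 - 1 = n * (#|F| - 1))%N.
  by rewrite cardF Dn divnK // !subn1 predn_exp dvdn_mulr.
have [S [v0 [nz_v0 SU genS]]] := singer_matrix Dn.
(* The points are numbered along the orbit of the Singer cycle. *)
pose pt (i : 'I_n) := v0 *m S ^+ i.
have pt0 i : pt i != 0.
  by rewrite rV_mulmx_unit_neq0 // -[_ ^+ _ \in _]/(_ ^+ _ \is a GRing.unit) unitrX.
have pt_inj := proportional_inj Dn pt0 genS.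
have genS' (v : 'rV_e.+1) : v != 0 -> exists k, (v <= v0 *m S ^+ k)%MS.
  by case/genS=> i; exists i.
(* The first [K] integers above a quarter of the dimension. The bound [4 * K + 4] keeps their
   doubles below the dimension. *)
pose t (j : 'I_K) := ((e.+1 %/ 4).+1 + j)%N.
have tP j : (0 < t j)%N /\ ((t j).*2 < e.+1 <= (t j).*2.*2)%N.
  have := ltn_ord j; rewrite /t; lia.
have /fin_all_exists2[x iso_x fix_x] j :=
  isolated_shift pt0 pt_inj genS nz_v0 SU genS' (tP j).1 (tP j).2.
(* Conjugate permutations have equally many fixed points, whereas these numbers increase strictly
   with [j]. *)
have inj_x : injective (fun j => x j ^: 'Alt_('I_n)).
  move=> i j eq_x; have : x i \in x j ^: 'Alt_('I_n) by rewrite -eq_x class_refl.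
  case/imsetP=> s _ Dxi.
  have /= := card_imset [set l | x j l == l] (@perm_inj _ s).
  have -> : s @: [set l | x j l == l] = [set l | x i l == l].
    apply/setP => l; rewrite -[l](permKV s) mem_imset; last exact: perm_inj.
    by rewrite !inE Dxi permJ (inj_eq perm_inj).
  rewrite !fix_x => eq_fix; apply/val_inj.
  have mono (l m : 'I_K) : (l < m)%N -> (#|shift_fix pt (t l).*2| < #|shift_fix pt (t m).*2|)%N.
    move=> lt_lm; apply: card_shift_fix => //.
    by have [_ /andP[/ltnW-> _]] := tP m; rewrite ltn_double ltn_add2l lt_lm.
  by case: (ltngtP i j) => // /mono; rewrite eq_fix ltnn.
rewrite -[K in (K <= _)%N]card_ord -(card_imset _ inj_x); apply: subset_leq_card.
by apply/subsetP => _ /imsetP[j _ ->].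
Qed.

End FiniteGeometry.

Local Open Scope classical_set_scope.

Theorem mainTheorem5 (q d n : nat -> nat)
    (q_pp : forall i, prime_power (q i))
    (d_ge2 : forall i, (2 <= d i)%N)
    (n_def : forall i, n i = ((q i ^ d i - 1) %/ (q i - 1))%N)
    (n_prime : forall i, prime (n i))
    (d_infty : d i @[i --> \oo] --> \oo) :
  #|lambda_isolated 'Alt_('I_(n i))%G| @[i --> \oo] --> \oo.
Proof.
move=> A [K _ leK_A].
have [N _ leN_d] : \oo (fun i => 4 * K + 4 <= d i)%N.
  by apply: (d_infty (fun m => 4 * K + 4 <= m)%N); exists (4 * K + 4)%N.
exists N => // i /leN_d leKd; apply: leK_A.
exact: many_isolated_Alt (q_pp i) (n_def i) leKd.
Qed.
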